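(* Let $\mathcal{W}=\{w_1,\dots,w_L\}\subset\mathbb{R}^{n_w}$ be a finite set, let $\widehat{\mathbb{P}}^N=(p_\ell^N)_{\ell=1}^L\in\Delta_L$ be the empirical distribution of $N$ samples from $\mathcal{W}$, let $\theta\ge0$, and let $$\mathcal{D}_{\ell_1}=\Bigl\{\mu\in\Delta_L:\ \tfrac12\|\mu-\widehat{\mathbb{P}}^N\|_1\le\theta\Bigr\}$$ be the total-variation ambiguity set. Let $\beta\in(0,1)$, $x\in\mathcal{X}$ and $g:\mathcal{X}\times\mathcal{W}\to\mathbb{R}$. Then $\sup_{\mu\in\mathcal{D}_{\ell_1}}\mathrm{CVaR}_\beta^{\mu}[g(x,w)]$ equals the optimal value of $$\begin{aligned}\inf\quad & 2\lambda\theta+\eta+\nu+\sum_{\ell=1}^L(\gamma_{1_\ell}-\gamma_{2_\ell})\,p_\ell^N\\ \text{s.t.}\quad &\beta(\gamma_{1_\ell}-\gamma_{2_\ell}+\nu)\ge[g(x,w_\ell)-\eta]_+,\quad \ell=1,\dots,L,\\ &\gamma_{1_\ell}+\gamma_{2_\ell}=\lambda,\quad \ell=1,\dots,L,\\ &\eta,\nu\in\mathbb{R},\quad \lambda,\gamma_{1_\ell},\gamma_{2_\ell}\in[0,\infty),\quad \ell=1,\dots,L.\end{aligned}$$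
   Context: $\Delta_L=\{\mu\in\mathbb{R}^L:\mu_\ell\ge0,\ \sum_{\ell=1}^L\mu_\ell=1\}$ is the unit simplex, identified with the probability distributions on $\mathcal{W}$ ($\mu_\ell$ is the probability of $w_\ell$). $p_\ell^N$ is the number of occurrences of $w_\ell$ among the $N$ samples divided by $N$. $\|\cdot\|_1$ is the $1$-norm, $[z]_+=\max(z,0)$. $\mathrm{CVaR}_\beta^{\mu}[Z]=\inf_{s\in\mathbb{R}}\{s+\beta^{-1}\mathbb{E}^{\mu}[Z-s]_+\}$. $\mathcal{X}\subset\mathbb{R}^{n_x}$ is the (compact) state constraint set, and $g$ is continuous. *)

(* Defs.v *)
From HB Require Import structures.
From mathcomp Require Import all_boot all_order all_algebra.
From mathcomp Require Import all_classical all_reals all_analysis.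
Import Order.TTheory GRing.Theory Num.Theory numFieldNormedType.Exports.

Set Implicit Arguments.
Unset Strict Implicit.
Unset Printing Implicit Defensive.

Local Open Scope classical_set_scope.
Local Open Scope ring_scope.

(* The finite set W is given by an enumeration
   w : 'I_L -> 'rV[R]_nw, assumed injective where it matters, and a probability
   distribution on W by the row vector mu of its weights, mu 0 l being the
   probability of w l.  Optimal values are taken in \bar R, so that no
   boundedness or nonemptiness convention is hidden in sup and inf. *)

Definition simplex (R : realType) (L : nat) : set 'rV[R]_L :=
  [set mu | (forall l, 0 <= mu 0 l) /\ \sum_(l < L) mu 0 l = 1].

(* The norm carried by 'rV[R]_L in the library is the sup norm. *)
Definition norm1 (R : realType) (L : nat) (v : 'rV[R]_L) : R :=
  \sum_(l < L) `|v 0 l|.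

Definition empirical (R : realType) (nw L N : nat) (w : 'I_L -> 'rV[R]_nw)
    (xi : 'I_N -> 'rV[R]_nw) : 'rV[R]_L :=
  \row_(l < L) (#|[set i : 'I_N | xi i == w l]%SET|%:R / N%:R).

Definition tv_ambiguity (R : realType) (L : nat) (p : 'rV[R]_L) (theta : R) :
    set 'rV[R]_L :=
  [set mu | simplex mu /\ 2^-1 * norm1 (mu - p) <= theta].

Definition pos_part (R : realType) (z : R) : R := Num.max z 0.

Definition expect (R : realType) (nw L : nat) (w : 'I_L -> 'rV[R]_nw)
    (mu : 'rV[R]_L) (Z : 'rV[R]_nw -> R) : R :=
  \sum_(l < L) mu 0 l * Z (w l).

Definition cvar (R : realType) (nw L : nat) (w : 'I_L -> 'rV[R]_nw)
    (beta : R) (mu : 'rV[R]_L) (Z : 'rV[R]_nw -> R) : \bar R :=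
  ereal_inf [set (s + beta^-1 * expect w mu (fun y => pos_part (Z y - s)))%:E
            | s in [set: R]].

(* Main.v *)
Require Import Defs.
From HB Require Import structures.
From mathcomp Require Import all_boot all_order all_algebra.
From mathcomp Require Import all_classical all_reals all_analysis.
From mathcomp Require Import ring lra.
Import Order.TTheory GRing.Theory Num.Theory numFieldNormedType.Exports.

Local Open Scope classical_set_scope.
Local Open Scope ring_scope.

(** Both sides are governed by one distribution, so no minimax theorem or linear
    programming duality is needed.

    Write [Z l] for the loss [g x (w l)].  For a fixed [s], the CVaR objective
    integrates [u |-> beta^-1 * pos_part (u - s)], a nondecreasing function of
    the loss.  Among the distributions within total variation [theta] of [p],
    the one that takes mass [min theta 1] away from the smallest losses and
    puts it on the largest loss dominates all the others stochastically; it is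
    therefore optimal for every [s] at once.  The construction is
    [trim_lower_tail] and [worst_case_distribution]; the latter gives the
    expected value of a nondecreasing [f] under it as at least
    [(m - t) * theta + \sum_l p l * max (f (Z l)) t], where [m] is the largest
    value of [f \o Z] and [t] its [theta]-quantile under [p] ([t = m] when
    [theta > 1]).

    For fixed [eta = s], the dual program attains exactly this number:
    clip [f \o Z] from below at [t] and centre the result in [[t, m]]
    ([dual_clipped_point]).  Hence the dual value is at most the CVaR of the
    worst-case distribution.  The opposite inequality is weak duality
    ([cvar_le_dual]). *)

Lemma empirical_simplex (R : realType) (nw L N : nat)
    (w : 'I_L -> 'rV[R]_nw) (xi : 'I_N -> 'rV[R]_nw) :
  injective w -> (0 < N)%N -> (forall i, range w (xi i)) ->
  simplex (empirical w xi).
Proof.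
move=> w_inj N_gt0 xi_in; split=> [l|]; first by rewrite mxE divr_ge0.
under eq_bigr do rewrite mxE.
rewrite -mulr_suml -natr_sum.
suff -> : (\sum_(l < L) #|[set i : 'I_N | xi i == w l]%SET| = N)%N.
  by rewrite divff// pnatr_eq0 -lt0n.
under eq_bigr do rewrite -sum1_card.
under eq_bigr do under eq_bigl do rewrite inE.
rewrite (exchange_big_dep xpredT)//= -[RHS]card_ord -sum1_card.
apply: eq_bigr => i _; have [l _ wl] := xi_in i.
rewrite (big_pred1 l)// => l' /=.
by rewrite -wl (inj_eq w_inj) eq_sym.
Qed.

(** Weak duality: take [s = eta] in the infimum defining CVaR.  Passing from
    [mu] to [p] in the integral of [gamma1 - gamma2] costs at most
    [lambda * norm1 (mu - p)], because [`|gamma1 - gamma2| <= lambda]. *)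
Lemma cvar_le_dual (R : realType) (nw L : nat) (w : 'I_L -> 'rV[R]_nw)
    (p mu : 'rV[R]_L) (theta beta : R) (Z : 'rV[R]_nw -> R)
    (lambda eta nu : R) (gamma1 gamma2 : 'rV[R]_L) :
  0 < beta -> tv_ambiguity p theta mu ->
  (forall l, pos_part (Z (w l) - eta)
             <= beta * (gamma1 0 l - gamma2 0 l + nu)) ->
  (forall l, gamma1 0 l + gamma2 0 l = lambda) ->
  0 <= lambda ->
  (forall l, 0 <= gamma1 0 l /\ 0 <= gamma2 0 l) ->
  (cvar w beta mu Z <=
   (2 * lambda * theta + eta + nu
    + \sum_(l < L) (gamma1 0 l - gamma2 0 l) * p 0 l)%:E)%E.
Proof.
move=> beta_gt0 [[mu_ge0 mu_sum1] mu_tv] feas gammaD lambda_ge0 gamma_ge0.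
apply: (@le_trans _ _
  (eta + beta^-1 * expect w mu (fun y => pos_part (Z y - eta)))%:E).
  by apply: ereal_inf_lbound; exists eta.
rewrite lee_fin /expect mulr_sumr.
pose S := \sum_(l < L) `|mu 0 l - p 0 l|.
have S_le : lambda * S <= 2 * lambda * theta.
  move: mu_tv; rewrite /norm1; under eq_bigr do rewrite !mxE.
  rewrite -/S => S_le; nra.
suff : \sum_(l < L) beta^-1 * (mu 0 l * pos_part (Z (w l) - eta)) <=
       nu + \sum_(l < L) (gamma1 0 l - gamma2 0 l) * p 0 l + lambda * S by lra.
rewrite -[nu]mulr1 -mu_sum1 /S !mulr_sumr -!big_split/=.
apply: ler_sum => l _.
apply: (@le_trans _ _ (mu 0 l * (gamma1 0 l - gamma2 0 l + nu))).
  by rewrite mulrCA ler_wpM2l// ler_pdivrMl.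
have : (gamma1 0 l - gamma2 0 l) * (mu 0 l - p 0 l)
       <= lambda * `|mu 0 l - p 0 l|.
  apply: (le_trans (ler_norm _)); rewrite normrM ler_wpM2r//.
  have [? ?] := gamma_ge0 l; have ? := gammaD l.
  by rewrite ler_norml; apply/andP; split; lra.
lra.
Qed.

Lemma quantile_index (R : realType) (L : nat) (p : 'rV[R]_L)
    (Z : 'I_L -> R) (theta : R) :
  simplex p -> 0 <= theta <= 1 ->
  exists k : 'I_L, \sum_(l < L | Z l < Z k) p 0 l <= theta
                   <= \sum_(l < L | Z l <= Z k) p 0 l.
Proof.
move=> [p_ge0 p_sum1] /andP[theta_ge0 theta_le1].
have [i0] : exists i : 'I_L, true.
  case: (posnP L) => [L0|L_gt0]; last by exists (Ordinal L_gt0).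
  move: p_sum1; rewrite big1 => [/esym/eqP|[i i_lt]]; first by rewrite oner_eq0.
  by exfalso; move: i_lt; rewrite L0.
move=> _.
have [M _ M_max'] := @arg_maxP _ _ _ i0 xpredT Z isT.
have M_max l : Z l <= Z M by exact: M_max'.
pose cdf k := \sum_(l < L | Z l <= Z k) p 0 l.
have cdfM : theta <= cdf M.
  rewrite (le_trans theta_le1)// -p_sum1 /cdf le_eqVlt; apply/orP; left.
  by apply/eqP/eq_bigl => l; rewrite M_max.
have [k cdf_k k_min] := @arg_minP _ _ _ M (fun k => theta <= cdf k) Z cdfM.
exists k; rewrite cdf_k andbT.
have [j0 j0_lt|no_lt] := pickP (fun l => Z l < Z k); last first.
  by rewrite big_pred0.
(* The mass strictly below Z k is the distribution function at the
   preceding value Z j, where it is still less than theta. *)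
have [j j_lt j_max] := @arg_maxP _ _ _ j0 (fun l => Z l < Z k) Z j0_lt.
have -> : \sum_(l < L | Z l < Z k) p 0 l = cdf j.
  apply: eq_bigl => l; apply/idP/idP => [/j_max //|Zlj].
  exact: le_lt_trans Zlj j_lt.
rewrite leNgt; apply/negP => /ltW /k_min.
by rewrite leNgt j_lt.
Qed.

(** Removing mass [theta] from the lower tail: the atoms below the quantile
    disappear, those above are kept, and those at the quantile are scaled by a
    common factor that adjusts the total. *)
Lemma trim_lower_tail (R : realType) (L : nat) (p : 'rV[R]_L)
    (Z : 'I_L -> R) (theta : R) :
  simplex p -> 0 <= theta <= 1 ->
  exists (k : 'I_L) (r : 'I_L -> R),
    [/\ forall l, 0 <= r l <= p 0 l,
        \sum_(l < L) r l = 1 - theta,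
        forall l, Z l < Z k -> r l = 0
      & forall l, Z k < Z l -> r l = p 0 l].
Proof.
move=> p_simplex theta01; have [p_ge0 p_sum1] := p_simplex.
have [k /andP[lt_theta theta_le]] := @quantile_index _ _ _ Z _ p_simplex theta01.
pose atom := \sum_(l < L | Z l == Z k) p 0 l.
pose below := \sum_(l < L | Z l < Z k) p 0 l.
pose above := \sum_(l < L | Z k < Z l) p 0 l.
have atom_ge0 : 0 <= atom by apply: sumr_ge0.
have cdfE : \sum_(l < L | Z l <= Z k) p 0 l = below + atom.
  rewrite (bigID (fun l => Z l < Z k))/=; congr (_ + _); apply: eq_bigl => l;
    by case: ltgtP.
have massE : below + atom + above = 1.
  rewrite -p_sum1 -cdfE [RHS](bigID (fun l => Z l <= Z k))/=; congr (_ + _).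
  by apply: eq_bigl => l; rewrite ltNge.
rewrite cdfE in theta_le.
(* If the atom is null then below + atom = theta, and the convention 0^-1 = 0
   still gives the right total mass. *)
pose a := (below + atom - theta) / atom.
have aE : a * atom = below + atom - theta.
  have [atom0|atom_neq0] := eqVneq atom 0; last by rewrite divfK.
  by move: lt_theta theta_le; rewrite -/below atom0 mulr0; lra.
have a01 : 0 <= a <= 1.
  rewrite divr_ge0//= ?subr_ge0//.
  have [atom0|atom_neq0] := eqVneq atom 0; first by rewrite /a atom0 invr0 mulr0.
  by rewrite ler_pdivrMr ?lt0r ?atom_neq0// mul1r; move: lt_theta; rewrite -/below; lra.
exists k, (fun l => if Z l < Z k then 0 else
                    if Z l == Z k then a * p 0 l else p 0 l).
split=> [l||l ->//|l lt_kl]; last by rewrite ltNge (ltW lt_kl) (gt_eqF lt_kl).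
  have := p_ge0 l; case: ifP => _; first by move=> ->; rewrite lexx.
  case: ifP => _ pl_ge0; last by rewrite pl_ge0 lexx.
  by case/andP: a01 => a_ge0 a_le1; rewrite mulr_ge0//= ler_piMl.
rewrite (bigID (fun l => Z l < Z k))/= big1 ?add0r => [|l ->//].
rewrite (bigID (fun l => Z l == Z k))/=.
have -> : \sum_(l < L | ~~ (Z l < Z k) && (Z l == Z k))
    (if Z l < Z k then 0 else if Z l == Z k then a * p 0 l else p 0 l)
    = a * atom.
  rewrite mulr_sumr; apply: eq_big => l; first by case: ltgtP.
  by move=> /andP[/negbTE -> ->].
have -> : \sum_(l < L | ~~ (Z l < Z k) && (Z l != Z k))
    (if Z l < Z k then 0 else if Z l == Z k then a * p 0 l else p 0 l)
    = above.
  apply: eq_big => l; first by case: ltgtP.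
  by move=> /andP[/negbTE -> /negbTE ->].
by rewrite aE; lra.
Qed.

(** The trimmed mass is put on an index [M] of maximal loss.  The pair [k, M] and
    the distribution do not depend on [f]: this uniformity is what allows the
    infimum over [s] to be taken after the worst case has been fixed. *)
Lemma worst_case_distribution (R : realType) (L : nat) (p : 'rV[R]_L)
    (Z : 'I_L -> R) (theta : R) :
  simplex p -> 0 <= theta ->
  exists (mu : 'rV[R]_L) (k M : 'I_L),
    [/\ tv_ambiguity p theta mu, forall l, Z l <= Z M
      & forall f : R -> R, {homo f : u v / u <= v} ->
        (f (Z M) - f (Z k)) * theta
          + \sum_(l < L) p 0 l * Num.max (f (Z l)) (f (Z k))
        <= \sum_(l < L) mu 0 l * f (Z l)].
Proof.
move=> p_simplex theta_ge0; have [p_ge0 p_sum1] := p_simplex.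
pose th := Num.min theta 1.
have th01 : 0 <= th <= 1 by rewrite /th le_min theta_ge0 ler01 ge_min lexx orbT.
have [k [r [r_bnd r_sum r_lo r_hi]]] := @trim_lower_tail _ _ _ Z _ p_simplex th01.
have [M _ M_max'] := @arg_maxP _ _ _ k xpredT Z isT.
have M_max l : Z l <= Z M by exact: M_max'.
pose mu : 'rV[R]_L := \row_l (r l + th * (l == M)%:R).
have deltaM (F : 'I_L -> R) : \sum_(l < L) (l == M)%:R * F l = F M.
  rewrite (bigD1 M)//= eqxx mul1r big1 ?addr0// => l /negbTE ->.
  by rewrite mul0r.
have sum_deltaM : \sum_(l < L) (l == M)%:R = 1 :> R.
  by have := deltaM (fun=> 1); under eq_bigr do rewrite mulr1.
have [th_ge0 th_le1] := andP th01.
have mu_ambiguity : tv_ambiguity p theta mu.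
  split; first split=> [l|].
  - by rewrite mxE; have /andP[? _] := r_bnd l; rewrite addr_ge0// mulr_ge0.
  - under eq_bigr do rewrite mxE.
    by rewrite big_split/= r_sum -mulr_sumr sum_deltaM; ring.
  - apply: (@le_trans _ _ th); last by rewrite /th ge_min lexx.
    rewrite ler_pdivrMl//.
    (* Removing and adding mass th contribute th each to the 1-norm. *)
    have -> : 2 * th = \sum_(l < L) (p 0 l - r l + th * (l == M)%:R).
      by rewrite big_split/= sumrB p_sum1 r_sum -mulr_sumr sum_deltaM; ring.
    apply: ler_sum => l _; rewrite !mxE.
    have /andP[r_ge0 r_le] := r_bnd l.
    have : 0 <= th * (l == M)%:R :> R by rewrite mulr_ge0.
    by move=> ?; rewrite ler_norml; apply/andP; split; lra.
have muE (F : 'I_L -> R) :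
    \sum_(l < L) mu 0 l * F l = \sum_(l < L) r l * F l + th * F M.
  under eq_bigr do rewrite mxE mulrDl -mulrA.
  by rewrite big_split/= -mulr_sumr deltaM.
have [theta_le1|theta_gt1] := leP theta 1.
- have thE : th = theta by rewrite /th min_l.
  exists mu, k, M; split=> // f f_mono.
  rewrite muE.
  (* Expressing theta as the removed mass makes the claim an equality term by
     term, in each of the three positions of Z l relative to Z k. *)
  have -> : (f (Z M) - f (Z k)) * theta = th * f (Z M)
      - \sum_(l < L) (p 0 l - r l) * f (Z k).
    by rewrite -mulr_suml sumrB p_sum1 r_sum thE; ring.
  rewrite -addrA [leRHS]addrC lerD2l addrC -sumrB le_eqVlt; apply/orP; left.
  apply/eqP/eq_bigr => l _; case: (ltgtP (Z l) (Z k)) => Zlk.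
  + by rewrite r_lo// max_r ?f_mono ?ltW//; ring.
  + by rewrite r_hi// max_l ?f_mono ?ltW//; ring.
  + by rewrite Zlk maxxx; ring.
- (* All of the mass may be moved, so that the threshold is the maximum. *)
  have thE : th = 1 by rewrite /th min_r// ltW.
  exists mu, M, M; split=> // f f_mono.
  rewrite muE thE subrr mul0r add0r mul1r.
  have r0 l : r l = 0.
    apply: (psumr_eq0P (P := xpredT)) => // [i _|]; first by have /andP[] := r_bnd i.
    by rewrite r_sum thE subrr.
  rewrite [X in _ <= X + _]big1 => [|l _]; last by rewrite r0 mul0r.
  rewrite add0r -[leRHS]mul1r -p_sum1 mulr_suml; apply: ler_sum => l _.
  by rewrite max_r ?f_mono.
Qed.

(** With [lambda] half the length of [[t, m]] and [nu] its midpoint, the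
    constraints on [gamma1, gamma2] say that [gamma1 - gamma2 + nu] takes its
    values in [[t, m]]; the least such function above [h] is [max h t]. *)
Lemma dual_clipped_point (R : realType) (L : nat) (p : 'rV[R]_L)
    (h : 'I_L -> R) (m t theta : R) :
  simplex p -> (forall l, h l <= m) -> t <= m ->
  exists (lambda nu : R) (gamma1 gamma2 : 'rV[R]_L),
    [/\ forall l, h l <= gamma1 0 l - gamma2 0 l + nu,
        forall l, gamma1 0 l + gamma2 0 l = lambda,
        0 <= lambda,
        forall l, 0 <= gamma1 0 l /\ 0 <= gamma2 0 l
      & 2 * lambda * theta + nu
          + \sum_(l < L) (gamma1 0 l - gamma2 0 l) * p 0 l
        = (m - t) * theta + \sum_(l < L) p 0 l * Num.max (h l) t].
Proof.
move=> [_ p_sum1] h_le t_le.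
pose c l := Num.max (h l) t.
have c_bnd l : [/\ h l <= c l, t <= c l & c l <= m].
  by rewrite /c ge_max h_le t_le !le_max !lexx orbT.
(* gamma1 - gamma2 = c - nu and gamma1 + gamma2 = lambda, where the interval
   [nu - lambda, nu + lambda] is [t, m]. *)
exists ((m - t) / 2), ((m + t) / 2),
  (\row_l ((c l - t) / 2)), (\row_l ((m - c l) / 2)).
split=> [l|l||l|]; rewrite ?mxE.
- by have [] := c_bnd l; lra.
- by field.
- by lra.
- by have [? ? ?] := c_bnd l; split; lra.
- have -> : \sum_(l < L)
      ((\row_i ((c i - t) / 2)) 0 l - (\row_i ((m - c i) / 2)) 0 l) * p 0 l
      = \sum_(l < L) (p 0 l * c l - (m + t) / 2 * p 0 l).
    by apply: eq_bigr => l _; rewrite !mxE; field.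
  by rewrite sumrB -mulr_sumr p_sum1 /c; field.
Qed.

Theorem mainTheorem8 (R : realType) (nx nw L N : nat)
    (w : 'I_L -> 'rV[R]_nw) (w_inj : injective w)
    (N_gt0 : (0 < N)%N)
    (xi : 'I_N -> 'rV[R]_nw) (xi_in : forall i, range w (xi i))
    (theta : R) (theta_ge0 : 0 <= theta)
    (beta : R) (beta_gt0 : 0 < beta) (beta_lt1 : beta < 1)
    (X : set 'rV[R]_nx) (X_compact : compact X)
    (g : 'rV[R]_nx -> 'rV[R]_nw -> R)
    (g_cont : {within X `*` range w, continuous (fun z => g z.1 z.2)})
    (x : 'rV[R]_nx) (xX : X x) :
  let p := empirical w xi in
  ereal_sup [set cvar w beta mu (g x) | mu in tv_ambiguity p theta] =
  ereal_inf [set v : \bar R |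
    exists (lambda eta nu : R) (gamma1 gamma2 : 'rV[R]_L),
      [/\ forall l : 'I_L, beta * (gamma1 0 l - gamma2 0 l + nu)
                           >= pos_part (g x (w l) - eta),
          forall l : 'I_L, gamma1 0 l + gamma2 0 l = lambda,
          0 <= lambda,
          forall l : 'I_L, 0 <= gamma1 0 l /\ 0 <= gamma2 0 l
        & v = (2 * lambda * theta + eta + nu
               + \sum_(l < L) (gamma1 0 l - gamma2 0 l) * p 0 l)%:E]].
Proof.
move=> p; have p_simplex : simplex p by exact: empirical_simplex.
apply/eqP; rewrite eq_le; apply/andP; split.
  apply: ge_ereal_sup => _ [mu mu_tv <-]; apply: le_ereal_inf_tmp.
  move=> _ [lambda [eta [nu [gamma1 [gamma2 [feas gammaD ? ? ->]]]]]].
  exact: cvar_le_dual.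
have [mu [k [M [mu_tv M_max worst]]]] :=
  @worst_case_distribution _ _ _ (fun l => g x (w l)) _ p_simplex theta_ge0.
apply: (@le_trans _ _ (cvar w beta mu (g x))); last first.
  by apply: ereal_sup_ubound; exists mu.
apply: le_ereal_inf_tmp => _ [s _ <-].
pose f u := beta^-1 * pos_part (u - s).
have f_mono : {homo f : u v / u <= v}.
  move=> u v uv; rewrite /f ler_pM2l ?invr_gt0// /pos_part.
  by rewrite ge_max !le_max lexx orbT andbT lerD2r uv.
have [lambda [nu [gamma1 [gamma2 [feas gammaD lambda_ge0 gamma_ge0 val]]]]] :=
  @dual_clipped_point _ _ _ (fun l => f (g x (w l))) _ _ theta p_simplex
    (fun l => f_mono _ _ (M_max l)) (f_mono _ _ (M_max k)).
apply: (@le_trans _ _ (2 * lambda * theta + s + nu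
               + \sum_(l < L) (gamma1 0 l - gamma2 0 l) * p 0 l)%:E).
  apply: ereal_inf_lbound; exists lambda, s, nu, gamma1, gamma2; split=> // l.
  by rewrite -ler_pdivrMl//; exact: feas.
have expectE : beta^-1 * expect w mu (fun y => pos_part (g x y - s))
    = \sum_(l < L) mu 0 l * f (g x (w l)).
  by rewrite /expect mulr_sumr; apply: eq_bigr => l _; rewrite mulrCA.
by rewrite lee_fin expectE; have := worst f f_mono; rewrite -val; lra.
Qed.
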